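(* Let $(X,d)$ be a compact metric space and $f:X\to X$ a continuous map. Then $$\mathcal{E}(f_{\mathcal{M}})=h_{top}(f).$$
   Context: $h_{top}(f)$ is the topological entropy of $f$. For $n\in\mathbb{N}$, $d_n(x,y)=\max_{0\le i\le n-1} d(f^ix,f^iy)$ is the $n$th Bowen metric. $\mathcal{M}(X)$ is the set of Borel probability measures on $X$ (weak* topology), and $f_{\mathcal M}:\mathcal M(X)\to\mathcal M(X)$ is $f_{\mathcal M}\mu=\mu\circ f^{-1}$. For $\mu,\nu\in\mathcal M(X)$, $\Pi(\mu,\nu)$ is the set of Borel probability measures on $X\times X$ with marginals $\mu$ and $\nu$, and $W_1^n(\mu,\nu)=\inf_{\pi\in\Pi(\mu,\nu)}\int d_n(x,y)\,d\pi(x,y)$. For nonempty $\mathcal Z\subset\mathcal M(X)$, $n\in\mathbb N$, $\varepsilon>0$, $N_{\mathcal M}(\mathcal Z,n,\varepsilon)$ is the smallest cardinality of a set $E\subset\mathcal M(X)$ such that for every $\mu\in\mathcal Z$ there is $\nu\in E$ with $W_1^n(\mu,\nu)\le\varepsilon$. The entropy order is $\mathcal E(f_{\mathcal M},\mathcal Z)=\lim_{\varepsilon\to0}\limsup_{n\to\infty}\frac{\log\log N_{\mathcal M}(\mathcal Z,n,\varepsilon)}{n}$ (convention $\log 0=0$), and $\mathcal E(f_{\mathcal M}):=\mathcal E(f_{\mathcal M},\mathcal M(X))$. *)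

(* Defs.v *)
From HB Require Import structures.
From mathcomp Require Import all_boot all_order all_algebra.
From mathcomp Require Import all_classical all_reals all_analysis.
From Stdlib Require List.
Set Implicit Arguments.
Unset Strict Implicit.
Unset Printing Implicit Defensive.
Import Order.TTheory GRing.Theory Num.Def Num.Theory.
Import numFieldTopology.Exports.
Local Open Scope classical_set_scope.
Local Open Scope ring_scope.

(* Nonempty metric spaces (mathcomp-analysis [metricType] with a point, the
   point being needed by mathcomp-analysis' measurable structures). *)
#[short(type="pointedMetricType")]
HB.structure Definition PointedMetric (K : numDomainType) :=
  { M of Pointed M & Metric K M }.

Section Defs.
Context {R : realType} {X : pointedMetricType R}.

Definition BorelX := g_sigma_algebraType (@open X).
Definition BorelXX := g_sigma_algebraType (@open (X * X)%type).

Definition probX := probability BorelX R.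
Definition probXX := probability BorelXX R.

Definition bowen (f : X -> X) (n : nat) (x y : X) : R :=
  \big[Num.max/0]_(i < n) mdist (iter i f x) (iter i f y).

Definition fM (f : X -> X) (mu : probX) : set BorelX -> \bar R :=
  fun A => mu (f @^-1` A).

Definition couplings (mu nu : probX) : set probXX :=
  [set pi : probXX |
     (forall A : set BorelX, measurable A -> pi (A `*` setT) = mu A) /\
     (forall A : set BorelX, measurable A -> pi (setT `*` A) = nu A)].

Definition W1n (f : X -> X) (n : nat) (mu nu : probX) : \bar R :=
  ereal_inf [set (\int[pi]_z (bowen f n z.1 z.2)%:E)%E | pi in couplings mu nu].

(* N_M(Z, n, eps): smallest cardinality of a finite E in M(X) such that every
   mu in Z is W_1^n-within eps of some nu in E (E given as a list; +oo if no
   finite such E exists). *)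
Definition NM (f : X -> X) (Z : set probX) (n : nat) (eps : R) : \bar R :=
  ereal_inf [set ((size E)%:R)%:E | E in
    [set E : seq probX | forall mu, Z mu ->
        exists nu, List.In nu E /\ (W1n f n mu nu <= eps%:E)%E]].

Definition Nspan (f : X -> X) (n : nat) (eps : R) : \bar R :=
  ereal_inf [set ((size F)%:R)%:E | F in
    [set F : seq X | forall x, exists y, List.In y F /\ bowen f n x y <= eps]].

Definition elog (x : \bar R) : \bar R :=
  match x with
  | EFin r => (if r <= 0 then 0 else ln r)%:E
  | +oo%E => +oo%E
  | -oo%E => 0%E
  end.

Definition entropy_order (f : X -> X) (Z : set probX) : \bar R :=
  lim ((limn_esup (fun n => elog (elog (NM f Z n.+1 eps)) * ((n.+1)%:R^-1)%:E)%E)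
        @[eps --> 0^'+]).

Definition htop (f : X -> X) : \bar R :=
  lim ((limn_esup (fun n => elog (Nspan f n.+1 eps) * ((n.+1)%:R^-1)%:E)%E)
        @[eps --> 0^'+]).

End Defs.

(* Main.v *)
Require Import Defs.
From HB Require Import structures.
From mathcomp Require Import all_boot all_order all_algebra.
From mathcomp Require Import all_classical all_reals all_analysis.
From mathcomp Require Import measurable_realfun ring lra.
From mathcomp.zify Require Import zify.
From Stdlib Require List.
Set Implicit Arguments.
Unset Strict Implicit.
Unset Printing Implicit Defensive.
Import Order.TTheory GRing.Theory Num.Def Num.Theory.
Import numFieldTopology.Exports.
Import numFieldNormedType.Exports.
Local Open Scope classical_set_scope.
Local Open Scope ring_scope.

(** Let [N(n, e)] be the spanning number for the Bowen metric [d_n].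

    Upper bound.  An [e]-spanning set cuts [X] into [N] cells on which [d_n] to
    the centre is at most [e].  Rounding the masses of the cells down to
    multiples of [1/m], and sending the mass lost in this way to a fixed point,
    moves a measure by at most [e + D N / m], where [D] bounds the diameter of
    [X].  With [m] of order [N] this gives at most [(m + 1)^N] measures, so
    [log log N_M] is at most [(1 + d) log N + C_d] for every [d > 0].

    Lower bound.  There are [N(n, e)] points at mutual [d_n]-distance greater
    than [e].  Arrange them in [k] pairs and attach to each word in [{0,1}^k]
    the uniform measure on the points it selects.  Integrating the 1-Lipschitz
    function [max(0, e - d_n(-, selected points))] shows that two words within
    [e/8] of the same measure agree on at least three quarters of the letters.
    Counting words weighted by [2^(number of agreements)], of total weight
    [3^k], shows that a ball of such words is exponentially smaller than [2^k],
    hence [log N_M] is at least a constant times [N(n, e)]. *)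

(** * Borel measurability of continuous maps *)

HB.instance Definition _ (T U : ptopologicalType) :=
  Topological.on (T * U)%type.

Section BorelMeasurability.
Context {T : ptopologicalType}.

Lemma open_borel_measurable (A : set T) :
  open A -> measurable (A : set (g_sigma_algebraType (@open T))).
Proof. by move=> oA; exact: sub_sigma_algebra. Qed.

Lemma continuous_borel_measurable (U : ptopologicalType) (h : T -> U) :
  continuous h ->
  measurable_fun [set: g_sigma_algebraType (@open T)]
    (h : g_sigma_algebraType (@open T) -> g_sigma_algebraType (@open U)).
Proof.
move=> /continuousP hc; apply: (measurability (@open U : set (set (g_sigma_algebraType (@open U))))) => //.
move=> _ [A oA <-]; rewrite setTI.
by apply: open_borel_measurable; exact: hc.
Qed.

Lemma continuous_borel_measurable_real (R : realType) (h : T -> R) :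
  continuous h -> measurable_fun [set: g_sigma_algebraType (@open T)] h.
Proof.
move=> /continuousP hc; apply: (measurability _ (RGenOpens.measurableE R)).
move=> _ [_ [a [b ->]] <-]; rewrite setTI.
by apply: open_borel_measurable; apply: hc; exact: interval_open.
Qed.

End BorelMeasurability.

(** * Continuity and metric properties of the Bowen distances *)

Lemma continuous_bigmax {R : realType} {T : topologicalType} {n : nat}
    (g : 'I_n -> T -> R) :
  (forall i, continuous (g i)) ->
  continuous (fun x => \big[Num.max/0]_(i < n) g i x).
Proof.
move=> gc x; elim: (index_enum _) => [|i s ih].
  by under eq_fun do rewrite big_nil; exact: cvg_cst.
rewrite (_ : (fun y => _) =
    g i \max (fun y => \big[Num.max/0]_(j <- s) g j y)); last first.
  by apply/funext => y; rewrite big_cons.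
exact: (@continuous_max R T (g i) _ x (gc i x) ih).
Qed.

Lemma continuous_mdist {R : realType} {X : metricType R} :
  continuous (fun z : X * X => mdist z.1 z.2).
Proof.
move=> [a b] /=; apply/cvgrPdist_lt => e e0 /=.
have e2 : 0 < e / 2 by rewrite divr_gt0.
exists (ball a (e / 2), ball b (e / 2)).
  by split; exact: nbhsx_ballx.
move=> [x y] [/=]; rewrite !ballEmdist /= => ax bt.
have := metric_triangle a x b; have := metric_triangle x y b.
have := metric_triangle x a y; have := metric_triangle a b y.
rewrite (metric_sym x a) (metric_sym y b) => h1 h2 h3 h4.
by rewrite ltr_norml; apply/andP; split; lra.
Qed.

Section Bowen.
Context {R : realType} {X : pointedMetricType R} (f : X -> X).
Implicit Types (n : nat) (x y z : X).

Lemma bowen_ge0 n x y : 0 <= bowen f n x y.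
Proof. exact: bigmax_ge_id. Qed.

Lemma bowenxx n x : bowen f n x x = 0.
Proof.
apply/le_anti; rewrite bowen_ge0 andbT.
by apply: bigmax_le => // i _; rewrite mdistxx.
Qed.

Lemma bowen_sym n x y : bowen f n x y = bowen f n y x.
Proof. by apply: eq_bigr => i _; exact: metric_sym. Qed.

Lemma bowen_triangle n x y z : bowen f n x z <= bowen f n x y + bowen f n y z.
Proof.
apply: bigmax_le => [|i _]; first by rewrite addr_ge0 ?bowen_ge0.
apply: le_trans (metric_triangle _ (iter i f y) _) _.
by apply: lerD; apply: (le_bigmax (I := 'I_n)).
Qed.

Lemma bowen_le n x y (D : R) :
  (forall x y : X, mdist x y <= D) -> bowen f n x y <= D.
Proof.
move=> hD; apply: bigmax_le => // .
by apply: le_trans (hD x x); rewrite mdistxx.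
Qed.

Hypothesis fc : continuous f.

Lemma continuous_iter i : continuous (iter i f).
Proof.
elim: i => [|i ih] x; first exact: cvg_id.
by apply: (@continuous_comp _ _ _ (iter i f) f); [exact: ih|exact: fc].
Qed.

Lemma continuous_bowen n : continuous (fun z : X * X => bowen f n z.1 z.2).
Proof.
apply: (continuous_bigmax (g := fun i (z : X * X) =>
  mdist (iter i f z.1) (iter i f z.2))) => i z.
apply: (@continuous_comp _ _ _
  (fun z : X * X => (iter i f z.1, iter i f z.2)) (fun z : X * X => mdist z.1 z.2)).
  apply: cvg_pair => /=.
    by apply: cvg_comp; [exact: cvg_fst|exact: continuous_iter].
  by apply: cvg_comp; [exact: cvg_snd|exact: continuous_iter].
exact: continuous_mdist.
Qed.

Lemma continuous_pairl (y : X) : continuous (fun x : X => (x, y)).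
Proof. by move=> x; apply: cvg_pair; [exact: cvg_id|exact: cvg_cst]. Qed.

Lemma continuous_bowenl n y : continuous (fun x => bowen f n x y).
Proof.
move=> x; apply: (@continuous_comp _ _ _ (fun x : X => (x, y))
  (fun z : X * X => bowen f n z.1 z.2)); first exact: continuous_pairl.
exact: continuous_bowen.
Qed.

End Bowen.

(** The distance to the base point attains a maximum by compactness, and the triangle inequality
    through that point doubles it. *)
Lemma compact_mdist_bounded {R : realType} {X : pointedMetricType R} :
  compact [set: X] -> exists2 D : R, 0 <= D & forall x y : X, mdist x y <= D.
Proof.
move=> cX.
have hc : {within [set: X], continuous (fun x : X => mdist point x)}.
  apply: continuous_subspaceT => x.
  apply: (@continuous_comp _ _ _ (fun x : X => (point, x))
    (fun z : X * X => mdist z.1 z.2)); last exact: continuous_mdist.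
  by apply: cvg_pair; [exact: cvg_cst|exact: cvg_id].
have [|c _ hm] := compact_EVT_max _ cX hc; first by exists point.
exists (mdist point c + mdist point c); first by rewrite addr_ge0 ?mdist_ge0.
move=> x y; apply: le_trans (metric_triangle _ point _) _.
by rewrite (metric_sym x); apply: lerD; apply: hm; rewrite inE.
Qed.

(** * Upper limits and minimal sizes of covers *)

(** The threshold on [n] may depend on both [r] and [d]. This lets a multiplicative error be
    absorbed into the additive [d] once the growth rate is known to be below [r]. *)
Lemma limn_esup_le {R : realType} (u v : nat -> \bar R) :
  (forall r d : R, 0 < d ->
    \forall n \near \oo, (v n < r%:E)%E -> (u n <= (r + d)%:E)%E) ->
  (limn_esup u <= limn_esup v)%E.
Proof.
move=> huv; apply: le_ereal_inf_tmp => _ [V FV <-].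
have [->|] := eqVneq (ereal_sup (v @` V)) +oo%E; first by rewrite leey.
rewrite -ltey => Vfin.
have key (r d : R) : (ereal_sup (v @` V) < r%:E)%E -> 0 < d ->
    (limn_esup u <= (r + d)%:E)%E.
  move=> Vr d0.
  pose W := V `&` [set n | (v n < r%:E)%E -> (u n <= (r + d)%:E)%E].
  have FW : nbhs \oo W by apply: filterI => //; exact: huv.
  apply: (@le_trans _ _ (ereal_sup (u @` W))).
    by apply: ereal_inf_lbound; exists W.
  apply: ge_ereal_sup => _ [n [Vn /= hn] <-]; apply: hn.
  by apply: le_lt_trans Vr; apply: ereal_sup_ubound; exists n.
case: (ereal_sup (v @` V)) Vfin key => [s| |] // _ key.
- apply/lee_addgt0Pr => e e0.
  have -> : (s%:E + e%:E = (s + e / 2 + e / 2)%:E)%E.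
    by rewrite -EFinD -addrA -splitr.
  by apply: key; rewrite ?lte_fin; lra.
(* When the supremum is [-oo], [key] holds for every real [r], which forces the upper limit of [u]
   down to [-oo] as well. *)
- case: (limn_esup u) key => [r| |] // key.
    by exfalso; have := key (r - 2) 1 (ltNyr _) ltr01; rewrite lee_fin {key}; lra.
  by have := key 0 1 (ltNyr _) ltr01; rewrite leye_eq.
Qed.

(** Sizes are natural numbers, so a nonempty family has a least one and the infimum is attained. *)
Lemma ereal_inf_size {R : realType} (T : Type) (P : set (seq T)) :
  (P = set0 /\ ereal_inf [set ((size E)%:R : R)%:E | E in P] = +oo%E) \/
  exists2 E, P E & ereal_inf [set ((size E)%:R : R)%:E | E in P] = (size E)%:R%:E.
Proof.
have [->|/set0P[E0 PE0]] := eqVneq P set0.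
  by left; rewrite image_set0 ereal_inf0.
right.
have ex : exists n, `[<exists2 E, P E & size E = n>].
  by exists (size E0); apply/asboolP; exists E0.
case: (ex_minnP ex) => n /asboolP[E PE sE] nmin.
exists E => //; apply/le_anti/andP; split.
  by apply: ereal_inf_lbound; exists E.
apply: le_ereal_inf_tmp => _ [E' PE' <-].
rewrite lee_fin ler_nat sE; apply: nmin.
by apply/asboolP; exists E'.
Qed.

(* Greedy selection: a separated list that does not span can be extended. *)
Lemma separated_of_Nspan {R : realType} {X : pointedMetricType R}
    (f : X -> X) (n : nat) (eps : R) (S : nat) :
  (S%:R%:E <= Nspan f n eps)%E ->
  exists2 s : seq X, size s = S &
    forall i j, (i < S)%N -> (j < S)%N -> i != j ->
      eps < bowen f n (nth point s i) (nth point s j).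
Proof.
elim: S => [|S ih] hS; first by exists [::].
have [|s sS sep] := ih.
  by apply: le_trans hS; rewrite lee_fin ler_nat.
have [x hx] : exists x, forall y, List.In y s -> eps < bowen f n x y.
  apply: contrapT => nx.
  have : (Nspan f n eps <= S%:R%:E)%E.
    apply: ereal_inf_lbound; exists s; last by rewrite sS.
    move=> x /=; apply: contrapT => hy; apply: nx; exists x => y ys.
    by rewrite ltNge; apply/negP => xy; apply: hy; exists y.
  by move=> /(le_trans hS); rewrite lee_fin ler_nat ltnn.
have hnth i : (i < S)%N -> List.In (nth point s i) s.
  rewrite -sS; elim: (s) i => // a t iht [|i] /=; first by left.
  by move=> it; right; exact: iht.
exists (rcons s x); first by rewrite size_rcons sS.
move=> i j; rewrite !ltnS !nth_rcons sS => iS jS ij.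
have [iS'|iS'] := ltnP i S; have [jS'|jS'] := ltnP j S.
- exact: sep.
- have -> : j = S by apply/eqP; rewrite eqn_leq jS.
  by rewrite eqxx bowen_sym; exact/hx/hnth.
- have -> : i = S by apply/eqP; rewrite eqn_leq iS.
  by rewrite eqxx; exact/hx/hnth.
- have : i == j by rewrite eqn_leq (leq_trans iS jS') (leq_trans jS iS').
  by rewrite (negbTE ij).
Qed.

(** * Counting binary words by their number of agreements *)

Definition agree (k : nat) (s t : {ffun 'I_k -> bool}) : nat :=
  #|[pred i | s i == t i]|.

(** The weight is a product over the letters; exchanging sum and product leaves the factor [2 + 1]
    for each letter, one term for agreement and one for disagreement. *)
Lemma agree_weight_sum (k : nat) (s : {ffun 'I_k -> bool}) :
  (\sum_(t : {ffun 'I_k -> bool}) 2 ^ agree s t = 3 ^ k)%N.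
Proof.
transitivity (\sum_(t : {ffun 'I_k -> bool})
    \prod_(i < k) (if s i == t i then 2 else 1))%N.
  apply: eq_bigr => t _; rewrite -big_mkcond /= prod_nat_const /agree.
  by [].
rewrite -(bigA_distr_bigA (fun (i : 'I_k) b => if s i == b then 2 else 1)%N).
rewrite -[in RHS](card_ord k) -prod_nat_const.
apply: eq_bigr => i _; rewrite big_bool; by case: (s i).
Qed.

(** Each word of [A] has weight at least [2 ^ (3k/4)] out of the total [3 ^ k]. Fourth powers keep
    the bound in integers, with [8 = 2 ^ 3] and [81 = 3 ^ 4]. *)
Lemma card_agree_ball (k : nat) (s : {ffun 'I_k -> bool})
    (A : {pred {ffun 'I_k -> bool}}) :
  (forall t, t \in A -> 3 * k <= 4 * agree s t)%N ->
  (#|A| ^ 4 * 8 ^ k <= 81 ^ k)%N.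
Proof.
move=> hA.
pose a := ((3 * k + 3) %/ 4)%N.
have h1 : (#|A| * 2 ^ a <= 3 ^ k)%N.
  rewrite -(agree_weight_sum s) -sum_nat_const.
  rewrite [leqRHS](bigID (mem A)) /=; apply: leq_trans (leq_addr _ _).
  by apply: leq_sum => t tA; rewrite leq_pexp2l //; have := hA _ tA; rewrite /a; lia.
have h2 : (8 ^ k <= (2 ^ a) ^ 4)%N.
  rewrite (_ : 8 = 2 ^ 3)%N // -!expnM leq_pexp2l// /a; lia.
apply: leq_trans (_ : (#|A| * 2 ^ a) ^ 4 <= _)%N.
  by rewrite expnMn leq_mul2l h2 orbT.
have -> : (81 ^ k = (3 ^ k) ^ 4)%N by rewrite -expnM mulnC expnM.
by rewrite leq_exp2r.
Qed.

(** Pigeonhole: the largest fibre has at least [2 ^ k / M] words, and [card_agree_ball] applies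
    around any of its members. The base [128] is [8 * 2 ^ 4]. *)
Lemma hamming_fibres (k M : nat) (g : {ffun 'I_k -> bool} -> 'I_M) :
  (forall s t, g s = g t -> 3 * k <= 4 * agree s t)%N ->
  (128 ^ k <= 81 ^ k * M ^ 4)%N.
Proof.
move=> hg; pose A (j : 'I_M) := [pred t | g t == j].
have cA j : (#|A j| ^ 4 * 8 ^ k <= 81 ^ k)%N.
  have [s /eqP gs|A0] := pickP (A j); last by rewrite (eq_card0 A0) exp0n ?mul0n.
  by apply: (card_agree_ball (s := s)) => t /eqP gt; apply: hg; rewrite gs gt.
have card2 : (2 ^ k = \sum_(j < M) #|A j|)%N.
  have := card_ffun 'I_k bool; rewrite card_bool card_ord => <-.
  rewrite -sum1_card (partition_big g predT) //=.
  by apply: eq_bigr => j _; rewrite -sum1_card.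
have M0 : (0 < #|'I_M|)%N.
  by rewrite card_ord; exact: leq_ltn_trans (ltn_ord (g [ffun=> false])).
have [j0 hmax] := bigop.eq_bigmax (fun j => #|A j|) M0.
have le2 : (2 ^ k <= M * #|A j0|)%N.
  rewrite card2; have -> : (M * #|A j0| = \sum_(j < M) #|A j0|)%N.
    by rewrite sum_nat_const card_ord.
  apply: leq_sum => j _.
  by rewrite -hmax; exact: (leq_bigmax (F := fun j => #|A j|)).
have -> : (128 ^ k = 8 ^ k * (2 ^ k) ^ 4)%N.
  by rewrite -expnM (mulnC k) expnM -expnMn.
apply: leq_trans (_ : 8 ^ k * (M * #|A j0|) ^ 4 <= _)%N.
  by rewrite leq_mul2l leq_exp2r // le2 orbT.
by rewrite expnMn mulnCA mulnC leq_mul2r mulnC cA orbT.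
Qed.

(** * Finitely supported probability measures *)

Section DiscreteMeasures.
Context {R : realType} {X : pointedMetricType R}.

Definition atoms (w : nat -> R) (p : nat -> X) (N : nat) :
    {measure set (@BorelX R X) -> \bar R} :=
  msum (fun i => mscale (`|w i|%:nng) (\d_(p i : @BorelX R X))) N.

(* Normalisation makes this a probability for all weights; it does nothing
   when the weights are nonnegative with sum [1]. *)
Definition discrete (w : nat -> R) (p : nat -> X) (N : nat) : @probX R X :=
  mnormalize (atoms w p N) (\d_(point : @BorelX R X)).

Context (w : nat -> R) (p : nat -> X) (N : nat).
Hypothesis w0 : forall i, 0 <= w i.
Hypothesis w1 : \sum_(i < N) w i = 1.

Lemma atomsE (A : set (@BorelX R X)) :
  atoms w p N A = (\sum_(i < N) (w i)%:E * \d_(p i : @BorelX R X) A)%E.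
Proof.
rewrite /atoms /= /msum; apply: eq_bigr => i _.
by transitivity (`|w i|%:E * \d_(p i : @BorelX R X) A)%E; rewrite ?ger0_norm.
Qed.

Lemma discrete_atoms (A : set (@BorelX R X)) : discrete w p N A = atoms w p N A.
Proof.
have aT : atoms w p N setT = 1%E.
  rewrite atomsE -[RHS]/(1%:E) -w1 -sumEFin; apply: eq_bigr => i _.
  by rewrite diracT mule1.
by rewrite /discrete /= /mnormalize aT onee_eq0 /= invr1 mule1.
Qed.

Lemma discreteE (A : set (@BorelX R X)) :
  discrete w p N A = (\sum_(i < N) (w i)%:E * \d_(p i : @BorelX R X) A)%E.
Proof. by rewrite discrete_atoms atomsE. Qed.

Lemma integral_discrete (h : X -> R) : continuous h -> (forall x, 0 <= h x) ->
  (\int[discrete w p N]_x (h x)%:E = (\sum_(i < N) w i * h (p i))%:E)%E.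
Proof.
move=> hc h0.
have mh : measurable_fun [set: @BorelX R X] (fun x => (h x)%:E).
  by apply/measurable_EFinP; exact: (@continuous_borel_measurable_real X).
rewrite (eq_measure_integral (atoms w p N)); last first.
  by move=> A _ _; exact: discrete_atoms.
rewrite ge0_integral_measure_sum //; last by move=> x _; rewrite lee_fin.
rewrite -sumEFin; apply: eq_bigr => i _.
rewrite ge0_integral_mscale //; last by move=> x _; rewrite lee_fin.
by rewrite integral_dirac // diracT mul1e /= ger0_norm // EFinM.
Qed.

End DiscreteMeasures.

(** * The easy half of Kantorovich duality for the Bowen distances *)

Section Duality.
Context {R : realType} {X : pointedMetricType R} (f : X -> X) (n : nat).
Hypothesis fc : continuous f.
Variable phi : X -> R.
Hypothesis phic : continuous phi.
Hypothesis phi0 : forall x, 0 <= phi x.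
Hypothesis phiL : forall x y, phi x <= phi y + bowen f n x y.
Implicit Types (mu nu : @probX R X).

Lemma borel_measurable_fst :
  measurable_fun [set: @BorelXX R X] (fst : @BorelXX R X -> @BorelX R X).
Proof.
apply: (@continuous_borel_measurable (X * X)%type X fst) => z; exact: cvg_fst.
Qed.

Lemma borel_measurable_snd :
  measurable_fun [set: @BorelXX R X] (snd : @BorelXX R X -> @BorelX R X).
Proof.
apply: (@continuous_borel_measurable (X * X)%type X snd) => z; exact: cvg_snd.
Qed.

Lemma coupling_integral_fst mu nu (pi : @probXX R X) : couplings mu nu pi ->
  (\int[mu]_x (phi x)%:E = \int[pi]_z (phi z.1)%:E)%E.
Proof.
move=> [pi1 _].
have mphi : measurable_fun [set: @BorelX R X] (fun x => (phi x)%:E).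
  by apply/measurable_EFinP; exact: (@continuous_borel_measurable_real X).
rewrite -[RHS](ge0_integral_pushforward borel_measurable_fst pi measurableT mphi).
  apply: eq_measure_integral; first exact: borel_measurable_fst.
  move=> ? A mA _; apply: etrans (esym (pi1 A mA)) _.
  by rewrite /pushforward; congr (pi _); apply/seteqP; split => -[a b] //= [].
by move=> y _; rewrite lee_fin.
Qed.

Lemma coupling_integral_snd mu nu (pi : @probXX R X) : couplings mu nu pi ->
  (\int[nu]_x (phi x)%:E = \int[pi]_z (phi z.2)%:E)%E.
Proof.
move=> [_ pi2].
have mphi : measurable_fun [set: @BorelX R X] (fun x => (phi x)%:E).
  by apply/measurable_EFinP; exact: (@continuous_borel_measurable_real X).
rewrite -[RHS](ge0_integral_pushforward borel_measurable_snd pi measurableT mphi).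
  apply: eq_measure_integral; first exact: borel_measurable_snd.
  move=> ? A mA _; apply: etrans (esym (pi2 A mA)) _.
  by rewrite /pushforward; congr (pi _); apply/seteqP; split => -[a b] //= [].
by move=> y _; rewrite lee_fin.
Qed.

(** Integrating [phi z.1 <= phi z.2 + bowen f n z.1 z.2] and its mirror image against a coupling
    bounds the difference of the two integrals by the cost of the coupling. *)
Lemma W1n_dual mu nu (d : R) : (W1n f n mu nu <= d%:E)%E ->
  (\int[mu]_x (phi x)%:E <= \int[nu]_x (phi x)%:E + d%:E)%E /\
  (\int[nu]_x (phi x)%:E <= \int[mu]_x (phi x)%:E + d%:E)%E.
Proof.
move=> hW.
have m1 : measurable_fun [set: @BorelXX R X] (fun z => (phi z.1)%:E).
  apply/measurable_EFinP; apply: (@continuous_borel_measurable_real (X * X)%type) => z.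
  by apply: (@continuous_comp _ _ _ fst phi); [exact: cvg_fst|exact: phic].
have m2 : measurable_fun [set: @BorelXX R X] (fun z => (phi z.2)%:E).
  apply/measurable_EFinP; apply: (@continuous_borel_measurable_real (X * X)%type) => z.
  by apply: (@continuous_comp _ _ _ snd phi); [exact: cvg_snd|exact: phic].
have mb : measurable_fun [set: @BorelXX R X] (fun z => (bowen f n z.1 z.2)%:E).
  apply/measurable_EFinP; apply: (@continuous_borel_measurable_real (X * X)%type).
  exact: continuous_bowen.
(* No optimal coupling is assumed: one of cost at most [d + e] is used, and [e] is then
   arbitrary. *)
suff key e : 0 < e ->
  (\int[mu]_x (phi x)%:E <= \int[nu]_x (phi x)%:E + d%:E + e%:E)%E /\
  (\int[nu]_x (phi x)%:E <= \int[mu]_x (phi x)%:E + d%:E + e%:E)%E.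
  by split; apply/lee_addgt0Pr => e /key[].
move=> e0.
have : (W1n f n mu nu < (d + e)%:E)%E.
  by apply: le_lt_trans hW _; rewrite lte_fin ltrDl.
move=> /ereal_inf_lt[_ [pi cpi <-] /ltW hpi].
rewrite (coupling_integral_fst cpi) (coupling_integral_snd cpi).
split; rewrite -addeA -EFinD; apply: le_trans (leeD2l _ hpi);
  rewrite -ge0_integralD //; try by (move=> z _; rewrite lee_fin ?bowen_ge0).
- apply: ge0_le_integral => //.
  + by move=> z _; rewrite lee_fin.
  + exact: emeasurable_funD.
  + by move=> z _; rewrite -EFinD lee_fin.
- apply: ge0_le_integral => //.
  + by move=> z _; rewrite lee_fin.
  + exact: emeasurable_funD.
  + by move=> z _; rewrite -EFinD lee_fin bowen_sym.
Qed.

End Duality.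

(** * Lower bound: uniform measures attached to binary words *)

Section LowerBound.
Context {R : realType} {X : pointedMetricType R} (f : X -> X) (n : nat).
Hypothesis fc : continuous f.
Variables (k : nat) (eps : R) (P : nat -> X).
Hypothesis k0 : (0 < k)%N.
Hypothesis eps0 : 0 < eps.
Hypothesis Psep : forall i j, (i < k.*2)%N -> (j < k.*2)%N -> i != j ->
  eps < bowen f n (P i) (P j).

Implicit Types s t : {ffun 'I_k -> bool}.

(* A word [s] selects one point in each of the pairs [P 2i, P (2i+1)]. *)
Definition select (s : {ffun 'I_k -> bool}) (i : nat) : X :=
  if insub i is Some j then P (s j + i.*2) else point.

Lemma selectE s (i : 'I_k) : select s i = P (s i + i.*2).
Proof. by rewrite /select valK. Qed.

Definition uniform_word (s : {ffun 'I_k -> bool}) : @probX R X :=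
  discrete (fun=> k%:R^-1) (select s) k.

Definition word_test (s : {ffun 'I_k -> bool}) (x : X) : R :=
  \big[Num.max/0]_(i < k) (eps - bowen f n x (P (s i + i.*2))).

Lemma word_test_ge0 s x : 0 <= word_test s x.
Proof. exact: bigmax_ge_id. Qed.

Lemma continuous_word_test s : continuous (word_test s).
Proof.
apply: (continuous_bigmax (g := fun (i : 'I_k) x =>
  eps - bowen f n x (P (s i + i.*2)))) => i x.
apply: cvgB; first exact: cvg_cst.
exact: continuous_bowenl.
Qed.

Lemma word_test_lip s x y : word_test s x <= word_test s y + bowen f n x y.
Proof.
apply: bigmax_le => [|i _]; first by rewrite addr_ge0 ?word_test_ge0 ?bowen_ge0.
have h : eps - bowen f n y (P (s i + i.*2)) <= word_test s y.
  exact: (le_bigmax (I := 'I_k)).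
have := bowen_triangle f n y x (P (s i + i.*2)).
by rewrite (bowen_sym f n y x) => h2; lra.
Qed.

Lemma word_test_eq s x (i : 'I_k) : x = P (s i + i.*2) -> word_test s x = eps.
Proof.
move=> ->; apply/le_anti/andP; split.
  apply: bigmax_le => [|j _]; first exact: ltW.
  by rewrite gerBl bowen_ge0.
have : eps - bowen f n (P (s i + i.*2)) (P (s i + i.*2)) <=
    word_test s (P (s i + i.*2)) by exact: (le_bigmax (I := 'I_k)).
by rewrite bowenxx subr0.
Qed.

(** Here [P (b + i.*2)] is the point of pair [i] that [s] rejects. It differs from every selected
    point, so separation makes all terms of the maximum negative. *)
Lemma word_test_neq s (i : 'I_k) (b : bool) : s i != b ->
  word_test s (P (b + i.*2)) = 0.
Proof.
move=> sib; apply/le_anti; rewrite word_test_ge0 andbT.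
apply: bigmax_le => // j _; rewrite subr_le0; apply/ltW/Psep.
- by have := ltn_ord i; case: b {sib}; lia.
- by have := ltn_ord j; case: (s j); lia.
have [->|ij] := eqVneq j i; first by case: (s i) b sib => -[] // _; lia.
have : (j : nat) != i by [].
by case: (s j); case: (b); lia.
Qed.

(** A letter contributes [eps / k] when the words agree there and nothing otherwise. *)
Lemma integral_word_test s t :
  (\int[uniform_word t]_x (word_test s x)%:E =
    (k%:R^-1 * eps * (agree s t)%:R)%:E)%E.
Proof.
have k0' : k%:R != 0 :> R by rewrite pnatr_eq0 -lt0n.
rewrite integral_discrete.
- congr EFin; rewrite -mulr_sumr -mulrA; congr (_ * _).
  rewrite /agree -sum1_card natr_sum mulr_sumr [RHS]big_mkcond /=.
  apply: eq_bigr => i _; rewrite selectE inE /= mulr1.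
  case: eqVneq => [e|ne]; last exact: word_test_neq.
  by apply: (@word_test_eq _ _ i); rewrite e.
- by move=> _; rewrite invr_ge0.
- by rewrite sumr_const card_ord -(mulr_natl (k%:R^-1)) mulfV.
- exact: continuous_word_test.
- exact: word_test_ge0.
Qed.

Lemma agree_xx (s : {ffun 'I_k -> bool}) : agree s s = k.
Proof. by rewrite -[RHS](card_ord k); apply: eq_card => i; rewrite !inE eqxx. Qed.

(** The test function of [s] has integral [eps] against its own measure. Passing to [nu] and then to
    the measure of [t] costs [eps / 8] each time, which leaves at least [3/4] of [eps]. *)
Lemma close_words s t (nu : @probX R X) :
  (W1n f n (uniform_word s) nu <= (eps / 8)%:E)%E ->
  (W1n f n (uniform_word t) nu <= (eps / 8)%:E)%E ->
  (3 * k <= 4 * agree s t)%N.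
Proof.
move=> hs ht.
have [h1 _] := W1n_dual fc (@continuous_word_test s) (@word_test_ge0 s)
  (@word_test_lip s) hs.
have [_ h2] := W1n_dual fc (@continuous_word_test s) (@word_test_ge0 s)
  (@word_test_lip s) ht.
have := le_trans h1 (leeD2r _ h2).
rewrite !integral_word_test agree_xx -!EFinD lee_fin.
have k0' : 0 < k%:R :> R by rewrite ltr0n.
move=> h; rewrite -(ler_nat R) !natrM.
have : eps * k%:R <= eps * ((agree s t)%:R + k%:R / 4).
  have := ler_wpM2l (ltW k0') h; rewrite !mulrDr !mulrA divff ?gt_eqF // !mul1r.
  by move=> h'; apply: le_trans h' _; rewrite le_eqVlt; apply/orP; left; apply/eqP; field.
by rewrite ler_pM2l // => h'; lra.
Qed.

Lemma NM_cover_lower (E : seq (@probX R X)) :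
  (forall mu, exists nu, List.In nu E /\ (W1n f n mu nu <= (eps / 8)%:E)%E) ->
  (128 ^ k <= 81 ^ k * size E ^ 4)%N.
Proof.
move=> hE.
have In_nth (nu : @probX R X) : List.In nu E ->
    exists j : 'I_(size E), nth (uniform_word [ffun=> false]) E j = nu.
  elim: (E) => // a E' ih /= [->|/ih[j hj]]; first by exists ord0.
  by exists (lift ord0 j).
have hex s : exists j : 'I_(size E),
    (W1n f n (uniform_word s) (nth (uniform_word [ffun=> false]) E j) <= (eps / 8)%:E)%E.
  by have [nu [/In_nth[j <-] hnu]] := hE (uniform_word s); exists j.
(* Each word is sent to the index of a covering measure close to it; words with the same index are
   then close to a common measure. *)
pose g s := projT1 (cid (hex s)).
have gP s := projT2 (cid (hex s)).
apply: (hamming_fibres (g := g)) => s t gst.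
apply: (close_words (gP s)); rewrite -/(g s) gst; exact: gP.
Qed.

End LowerBound.

(** * Transport plans onto finitely supported measures *)

Lemma borel_measurable_pairl {R : realType} {X : pointedMetricType R} (y : X) :
  measurable_fun [set: @BorelX R X] (fun x : @BorelX R X => (x, y) : @BorelXX R X).
Proof.
apply: (@continuous_borel_measurable X (X * X)%type) => x.
exact: continuous_pairl.
Qed.

(** The copy of [m] carried by the points with second coordinate [y], bundled as a measure so that
    it can enter [mscale] and [measure_add]. *)
Definition slice {R : realType} {X : pointedMetricType R}
    (m : {measure set (@BorelX R X) -> \bar R}) (y : X) :
  {measure set (@BorelXX R X) -> \bar R}.
Proof.
refine (pushforward m (fun x : @BorelX R X => (x, y) : @BorelXX R X)).
exact: borel_measurable_pairl.
Defined.

Section Transport.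
Context {R : realType} {X : pointedMetricType R} (f : X -> X) (n : nat).
Hypothesis fc : continuous f.
Variables (mu : @probX R X) (N : nat) (A : nat -> set (@BorelX R X)).
Variables (y : nat -> X) (q : nat -> R) (eps D : R).
Hypothesis mA : forall i, measurable (A i).
Hypothesis tA : trivIset setT A.
Hypothesis covA : \big[setU/set0]_(i < N) A i = setT.
Hypothesis q0 : forall i, 0 <= q i.
Hypothesis qp : forall i, ((q i)%:E <= mu (A i))%E.
Hypothesis eps0 : 0 <= eps.
Hypothesis Ay : forall i x, A i x -> bowen f n x (y i) <= eps.
Hypothesis hD : forall x y : X, mdist x y <= D.

(** The index [N] lies beyond the cells and receives the mass lost in lowering the cell masses to
    [q]. *)
Definition transport_weight (i : nat) : R :=
  if (i < N)%N then q i else 1 - \sum_(j < N) q j.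

Let p i := fine (mu (A i)).
Let theta i := q i / p i.

(* On the cell [A i] a proportion [theta i] of the mass goes to [y i], and the
   rest goes to [y N]. *)
Let piece (i : nat) : {measure set (@BorelXX R X) -> \bar R} :=
  measure_add (mscale (`|theta i|%:nng) (slice (mrestr mu (mA i)) (y i)))
              (mscale (`|1 - theta i|%:nng) (slice (mrestr mu (mA i)) (y N))).

Let total : {measure set (@BorelXX R X) -> \bar R} := msum piece N.

(** Normalisation serves to bundle the plan as a probability; [total] already has mass one, as shown
    inside [planE]. *)
Let plan : @probXX R X :=
  mnormalize total (\d_((point, point) : @BorelXX R X)).

Let r (B : set (@BorelX R X)) : R := fine (mu B).

Let rE B : measurable B -> mu B = (r B)%:E.
Proof. by move=> mB; rewrite /r fineK // fin_num_measure. Qed.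

Let pE i : mu (A i) = (p i)%:E. Proof. exact: rE. Qed.

Let r_ge0 B : 0 <= r B. Proof. exact: fine_ge0. Qed.

Let qlep i : q i <= p i. Proof. by have := qp i; rewrite pE lee_fin. Qed.

(** If [p i] vanishes then so does [q i], squeezed between [0] and [p i]; the value of a division by
    zero is therefore harmless. *)
Let theta_p i : theta i * p i = q i.
Proof.
have [p0|p0] := eqVneq (p i) 0; last by rewrite /theta divfK.
by rewrite p0 mulr0; apply/le_anti; rewrite q0 -p0 qlep.
Qed.

Let theta_ge0 i : 0 <= theta i.
Proof. by rewrite divr_ge0 // r_ge0. Qed.

Let theta_le1 i : 0 <= 1 - theta i.
Proof.
rewrite subr_ge0 /theta; have [p0|p0] := eqVneq (p i) 0.
  by rewrite p0 invr0 mulr0.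
by rewrite ler_pdivrMr ?mul1r ?qlep // lt_def p0 r_ge0.
Qed.

Let r_sum B : measurable B -> \sum_(i < N) r (B `&` A i) = r B.
Proof.
move=> mB; apply: EFin_inj; rewrite -rE // -sumEFin.
have eB : \big[setU/set0]_(i < N) (B `&` A i) = B.
  by rewrite -big_distrr /= covA setIT.
rewrite -[in RHS]eB measure_bigsetU_ord /=.
- by apply: eq_bigr => i _; rewrite rE //; exact: measurableI.
- by move=> i; exact: measurableI.
- apply/trivIsetP => i j _ _ ij; rewrite setIACA.
  by move/trivIsetP : tA => -> //; rewrite setI0.
Qed.

Let p_sum : \sum_(i < N) p i = 1.
Proof.
transitivity (r setT); last by rewrite /r probability_setT.
by rewrite -r_sum //; apply: eq_bigr => i _; rewrite setTI.
Qed.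

Let residual : 1 - \sum_(j < N) q j = \sum_(j < N) (p j - q j).
Proof. by rewrite sumrB p_sum. Qed.

Let pre (v : X) (C : set (@BorelXX R X)) : set (@BorelX R X) :=
  (fun x => (x, v)) @^-1` C.

Let mpre v C : measurable C -> measurable (pre v C).
Proof.
move=> mC; rewrite /pre -[X in measurable X]setTI.
exact: (borel_measurable_pairl v measurableT mC).
Qed.

Let sumE C : measurable C -> total C =
  (\sum_(i < N) (theta i * r (pre (y i) C `&` A i)
               + (1 - theta i) * r (pre (y N) C `&` A i)))%:E.
Proof.
move=> mC; rewrite /total /= /msum -sumEFin; apply: eq_bigr => i _.
rewrite [LHS](measure_addE _ _ C) EFinD !EFinM -!rE; last 2 first.
- by apply: measurableI => //; exact: mpre.
- by apply: measurableI => //; exact: mpre.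
transitivity (`|theta i|%:E * mu (pre (y i) C `&` A i)
            + `|1 - theta i|%:E * mu (pre (y N) C `&` A i))%E; first by [].
by rewrite !ger0_norm.
Qed.

Let planE C : measurable C -> plan C =
  (\sum_(i < N) (theta i * r (pre (y i) C `&` A i)
               + (1 - theta i) * r (pre (y N) C `&` A i)))%:E.
Proof.
have sT : total setT = 1%E.
  transitivity ((\sum_(i < N) p i)%:E); last by rewrite p_sum.
  rewrite sumE //; congr EFin; apply: eq_bigr => i _.
  by rewrite /pre preimage_setT setTI -/(p i) -mulrDl addrC subrK mul1r.
by move=> mC; rewrite -sumE // /plan /= /mnormalize sT onee_eq0 /= invr1 mule1.
Qed.

Let weight_ge0 i : 0 <= transport_weight i.
Proof.
rewrite /transport_weight; case: ifP => // _.
by rewrite residual; apply: sumr_ge0 => j _; rewrite subr_ge0.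
Qed.

Let weight_sum : \sum_(i < N.+1) transport_weight i = 1.
Proof.
rewrite big_ord_recr /= /transport_weight ltnn.
by under eq_bigr do rewrite ltn_ord; rewrite addrC subrK.
Qed.

Let plan_fst (B : set (@BorelX R X)) : measurable B -> plan (B `*` setT) = mu B.
Proof.
move=> mB; rewrite planE; last first.
  rewrite (_ : B `*` setT = setT `&` fst @^-1` B); last first.
    by rewrite setTI; apply/seteqP; split => -[a b] //= [].
  exact: (borel_measurable_fst measurableT mB).
rewrite rE // -(r_sum mB); congr EFin; apply: eq_bigr => i _.
have e v : pre v (B `*` setT) = B by apply/seteqP; split => x //= [].
by rewrite !e -mulrDl addrC subrK mul1r.
Qed.

Let plan_snd (B : set (@BorelX R X)) : measurable B ->
  plan (setT `*` B) = discrete transport_weight y N.+1 B.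
Proof.
move=> mB; rewrite planE; last first.
  rewrite (_ : setT `*` B = setT `&` snd @^-1` B); last first.
    by rewrite setTI; apply/seteqP; split => -[a b] //= [].
  exact: (borel_measurable_snd measurableT mB).
have e v i : r (pre v (setT `*` B) `&` A i) = \1_B v * p i.
  rewrite indicE; have [vB|vB] := boolP (v \in B).
    rewrite (_ : pre v _ = setT) ?setTI ?mul1r //.
    by apply/seteqP; split => // x _; split => //=; rewrite inE in vB.
  rewrite (_ : pre v _ = set0) ?set0I ?mul0r ?/r ?measure0 //.
  by apply/seteqP; split => // x [_ /=] vB'; rewrite notin_setE in vB.
rewrite discreteE // big_ord_recr /= diracE.
under eq_bigr do rewrite !e.
rewrite (_ : (\sum_(i < N) _)%E = (\sum_(i < N) q i * \1_B (y i))%:E); last first.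
  rewrite -sumEFin; apply: eq_bigr => i _.
  by rewrite /transport_weight ltn_ord diracE indicE.
rewrite -EFinM -EFinD; congr EFin.
rewrite /transport_weight ltnn residual mulr_suml -big_split /=.
apply: eq_bigr => i _; rewrite !indicE -(theta_p i); ring.
Qed.

(** Mass sent to the centre of its own cell travels at most [eps]. Only the residual mass can travel
    farther, and then at most [D]. *)
Lemma transport_cost :
  (W1n f n mu (discrete transport_weight y N.+1) <=
   (eps + D * (1 - \sum_(j < N) q j))%:E)%E.
Proof.
have D0 : 0 <= D by apply: le_trans (hD point point); rewrite mdistxx.
have mb : measurable_fun [set: @BorelXX R X] (fun z => bowen f n z.1 z.2).
  apply: (@continuous_borel_measurable_real (X * X)%type).
  exact: continuous_bowen.
pose bad : set (@BorelXX R X) := [set z | eps < bowen f n z.1 z.2].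
have mbad : measurable bad.
  rewrite (_ : bad = setT `&` (fun z => bowen f n z.1 z.2) @^-1` `]eps, +oo[%classic).
    exact: mb.
  by rewrite setTI; apply/seteqP; split => z; rewrite /= in_itv /= andbT.
apply: (@le_trans _ _ (\int[plan]_z (bowen f n z.1 z.2)%:E)%E).
  by apply: ereal_inf_lbound; exists plan => //.
apply: (@le_trans _ _ (\int[plan]_z (eps%:E + D%:E * (\1_bad z)%:E))%E).
  apply: ge0_le_integral => //.
  - by move=> z _; rewrite lee_fin bowen_ge0.
  - exact/measurable_EFinP.
  - apply/measurable_EFinP; apply: measurable_funD => //.
    by apply: measurable_funM => //; exact: measurable_indic.
  - move=> z _; rewrite -EFinM -EFinD lee_fin indicE.
    have [zb|zb] := boolP (z \in bad).
      by rewrite mulr1; apply: le_trans (bowen_le f n z.1 z.2 hD) _; rewrite lerDr.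
    by rewrite mulr0 addr0 leNgt; apply/negP => h; rewrite notin_setE in zb.
rewrite ge0_integralD //; last 2 first.
- by move=> z _; rewrite -EFinM lee_fin mulr_ge0.
- by apply/measurable_EFinP; apply: measurable_funM => //; exact: measurable_indic.
rewrite integral_cst // [X in (_ * X + _)%E](_ : _ = 1%E); last first.
  exact: probability_setT.
rewrite mule1.
rewrite ge0_integralZl //; last exact/measurable_EFinP/measurable_indic.
rewrite integral_indic // setIT [X in (_ * X)%E](planE mbad).
rewrite -EFinM -EFinD lee_fin lerD2l.
apply: ler_wpM2l => //; rewrite residual; apply: ler_sum => i _.
(* A point of [A i] sent to [y i] is never bad, so only the share sent to [y N] remains. *)
rewrite (_ : pre (y i) bad `&` A i = set0); last first.
  apply/seteqP; split => // x [/= h /Ay].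
  by rewrite leNgt h.
rewrite {1}/r measure0 mulr0 add0r -(theta_p i) -{1}[p i]mul1r -mulrBl.
apply: ler_wpM2l => //.
rewrite -lee_fin -pE -rE; last by apply: measurableI => //; exact: mpre.
by apply: le_measure; rewrite ?inE //; apply: measurableI => //; exact: mpre.
Qed.

End Transport.

(** * Upper bound: a finite grid of measures *)

Section Covering.
Context {R : realType} {X : pointedMetricType R} (f : X -> X) (n : nat).
Hypothesis fc : continuous f.
Variables (s : seq X) (eps D : R) (m : nat).
Hypothesis eps0 : 0 <= eps.
Hypothesis m0 : (0 < m)%N.
Hypothesis hD : forall x y : X, mdist x y <= D.
Hypothesis span : forall x, exists y, List.In y s /\ bowen f n x y <= eps.

Local Notation N := (size s).

Definition grid_coef (k : {ffun 'I_N -> 'I_m.+1}) (i : nat) : R :=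
  if insub i is Some j then (k j)%:R / m%:R else 0.

(** At index [N], past the end of the list, [nth point s] returns its default [point]: this is the
    fixed point that receives the lost mass. *)
Definition grid_measure (k : {ffun 'I_N -> 'I_m.+1}) : @probX R X :=
  discrete (transport_weight N (grid_coef k)) (nth point s) N.+1.

(** Rounding [m * p] down loses at most [1 / m] in each cell, hence at most [N / m] in all, and this
    mass travels at most [D]. *)
Lemma grid_approx (mu : @probX R X) :
  exists k, (W1n f n mu (grid_measure k) <= (eps + D * (N%:R / m%:R))%:E)%E.
Proof.
have m0' : 0 < m%:R :> R by rewrite ltr0n.
pose F i : set (@BorelX R X) := [set x | bowen f n x (nth point s i) <= eps].
have mF i : measurable (F i).
  have mb : measurable_fun [set: @BorelX R X]
      (fun x => bowen f n x (nth point s i)).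
    by apply: (@continuous_borel_measurable_real X); exact: continuous_bowenl.
  rewrite (_ : F i = setT `&`
      (fun x => bowen f n x (nth point s i)) @^-1` `]-oo, eps]%classic).
    exact: mb.
  by rewrite setTI; apply/seteqP; split => z; rewrite /= in_itv.
have covF : \big[setU/set0]_(i < N) F i = setT.
  apply/seteqP; split => // x _; rewrite -bigcup_mkord.
  have [y [ys xy]] := span x.
  suff [i iN yi] : exists2 i, (i < N)%N & nth point s i = y.
    by exists i => //; rewrite /F /= yi.
  elim: (s) ys => // a t ih /= [->|/ih[i it hi]]; first by exists 0%N.
  by exists i.+1.
pose A := seqDU F.
have mA i : measurable (A i) by exact: seqDU_measurable.
pose p i := fine (mu (A i)).
have pE i : mu (A i) = (p i)%:E by rewrite /p fineK // fin_num_measure.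
have p0 i : 0 <= p i by exact: fine_ge0.
have p1 i : p i <= 1 by rewrite -lee_fin -pE; exact: probability_le1.
have mp0 i : 0 <= m%:R * p i by rewrite mulr_ge0.
(* [inord] is faithful here, since [p j <= 1] keeps the truncation at most [m]. *)
pose k := [ffun j : 'I_N => inord (Num.truncn (m%:R * p j)) : 'I_m.+1].
have kE (j : 'I_N) : (k j : nat) = Num.truncn (m%:R * p j).
  rewrite ffunE inordK // ltnS -(ler_nat R).
  have /andP[h _] := truncn_itv (mp0 j).
  by apply: le_trans h _; rewrite ler_piMr.
have cE (j : 'I_N) : grid_coef k j = (Num.truncn (m%:R * p j))%:R / m%:R.
  by rewrite /grid_coef valK kE.
exists k.
have q0 i : 0 <= grid_coef k i.
  by rewrite /grid_coef; case: insubP => // j _ _; rewrite divr_ge0.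
have qp i : ((grid_coef k i)%:E <= mu (A i))%E.
  rewrite pE lee_fin; have [iN|iN] := ltnP i N.
    rewrite -[i]/(nat_of_ord (Ordinal iN)) cE ler_pdivrMr // /=.
    by have /andP[+ _] := truncn_itv (mp0 i); rewrite [p i * _]mulrC.
  by rewrite /grid_coef insubF // ltnNge iN.
have Ay i x : A i x -> bowen f n x (nth point s i) <= eps.
  by move=> Aix; exact: (subset_seqDU Aix).
have covA : \big[setU/set0]_(i < N) A i = setT by rewrite -bigsetU_seqDU.
apply: le_trans (transport_cost fc mA (trivIset_seqDU F) covA q0 qp eps0 Ay hD) _.
rewrite lee_fin lerD2l; apply: ler_wpM2l.
  by apply: le_trans (hD point point); rewrite mdistxx.
have p_sum : \sum_(j < N) p j = 1.
  apply: EFin_inj; rewrite -sumEFin.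
  transitivity (mu (\big[setU/set0]_(i < N) A i)).
    rewrite (measure_bigsetU_ord mu predT) //=.
      by apply: eq_bigr => i _; rewrite pE.
    apply/trivIsetP => i j _ _ ij.
    by have /trivIsetP := trivIset_seqDU F; apply.
  by rewrite covA probability_setT.
have -> : 1 - \sum_(j < N) grid_coef k j = \sum_(j < N) (p j - grid_coef k j).
  by rewrite sumrB p_sum.
apply: (@le_trans _ _ (\sum_(j < N) m%:R^-1)).
  apply: ler_sum => j _; rewrite cE -(ler_pM2l m0') mulrBr divff ?gt_eqF //.
  have /andP[_] := truncn_itv (mp0 j); rewrite mulrC -natr1 mulrC => h.
  by rewrite mulrCA divff ?gt_eqF // mulr1; lra.
by rewrite sumr_const card_ord -(mulr_natl (m%:R^-1)).
Qed.

Lemma grid_cover : exists2 E : seq (@probX R X), size E = (m.+1 ^ N)%N &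
  forall mu, exists nu, List.In nu E /\
    (W1n f n mu nu <= (eps + D * (N%:R / m%:R))%:E)%E.
Proof.
exists [seq grid_measure k | k <- enum {ffun 'I_N -> 'I_m.+1}].
  by rewrite size_map -cardE card_ffun !card_ord.
move=> mu; have [k hk] := grid_approx mu; exists (grid_measure k); split => //.
apply: List.in_map.
have : k \in enum {ffun 'I_N -> 'I_m.+1} by rewrite mem_enum.
elim: (enum _) => // a t ih; rewrite inE => /orP[/eqP ->|/ih]; first by left.
by right.
Qed.

End Covering.

(** * Estimates for the iterated logarithm *)

Section LogLog.
Context {R : realType}.

(** The case [M = 1] encodes the convention that the logarithm of zero is zero. *)
Definition loglog (M : nat) : R := if M == 1%N then 0 else ln (ln M%:R).

Lemma elog_nat (M : nat) : (0 < M)%N -> elog (M%:R : R)%:E = (ln (M%:R : R))%:E.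
Proof. by move=> M0; rewrite /elog leNgt ltr0n M0. Qed.

Lemma ln_nat_gt0 (M : nat) : (1 < M)%N -> 0 < ln (M%:R : R).
Proof. by move=> M1; rewrite ln_gt0 // ltr1n. Qed.

Lemma elog_elog_nat (M : nat) : (0 < M)%N ->
  elog (elog (M%:R : R)%:E) = (loglog M)%:E.
Proof.
move=> M0; rewrite elog_nat // /loglog; have [->|M1] := eqVneq M 1%N.
  by rewrite ln1 /= lexx.
by rewrite /elog leNgt ln_nat_gt0 // ltn_neqAle eq_sym M1.
Qed.

Lemma ler_ln_nat (a b : nat) : (0 < a)%N -> (a <= b)%N ->
  ln (a%:R : R) <= ln b%:R.
Proof.
move=> a0 ab; rewrite ler_ln ?ler_nat // posrE ltr0n //.
exact: leq_trans ab.
Qed.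

(** [loglog] is not monotone: it drops from [0] at [1] to the negative number [ln (ln 2)] at [2],
    where its least value lies. *)
Lemma loglog_ge (M : nat) : (0 < M)%N -> - `|ln (ln 2%:R)| <= loglog M.
Proof.
move=> M0; rewrite /loglog; case: eqVneq => [_|M1]; first by rewrite oppr_le0.
apply: le_trans (_ : ln (ln 2%:R) <= _); first by rewrite lerNl -normrN ler_norm.
have M2 : (1 < M)%N by rewrite ltn_neqAle eq_sym M1.
by rewrite ler_ln ?posrE ?ln_nat_gt0 //; exact: ler_ln_nat.
Qed.

(** This is [ln t <= t] at [t = d * y]; it trades a double logarithm for a small multiple of a
    logarithm. *)
Lemma ln_le_linear (d y : R) : 0 < d -> 0 < y -> ln y <= d * y - ln d.
Proof.
move=> d0 y0; have := ln_sublinear (mulr_gt0 d0 y0).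
by rewrite lnM ?posrE // => /ltW h; rewrite lerBrDl.
Qed.

(** Two logarithms give [ln N + ln (ln (m + 1))]. The second term is at most
    [d * ln (m + 1) - ln d], and [ln (m + 1) <= ln K + ln N]. *)
Lemma loglog_le (M N m : nat) (K d : R) : (0 < M)%N -> (0 < N)%N -> (0 < m)%N ->
  (M <= m.+1 ^ N)%N -> m.+1%:R <= K * N%:R -> 1 <= K -> 0 < d -> d <= 1 ->
  loglog M <= (1 + d) * ln N%:R + (ln K - ln d).
Proof.
move=> M0 N0 m0 MmN mK K1 d0 d1.
have lnN : 0 <= ln N%:R :> R by rewrite ln_ge0 // ler1n.
have lnK : 0 <= ln K by exact: ln_ge0.
have lnd : ln d <= 0 by exact: ln_le0.
rewrite /loglog; case: eqVneq => [_|M1].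
  have : 0 <= (1 + d) * ln N%:R by rewrite mulr_ge0 // addr_ge0 // ltW.
  by move=> ?; lra.
have M2 : (1 < M)%N by rewrite ltn_neqAle eq_sym M1.
have lm : 0 < ln m.+1%:R :> R by exact: ln_nat_gt0.
have N0' : 0 < N%:R :> R by rewrite ltr0n.
have h1 : ln (ln M%:R) <= ln N%:R + ln (ln m.+1%:R) :> R.
  rewrite -lnM ?posrE // ler_ln ?posrE ?ln_nat_gt0 ?mulr_gt0 //.
  by rewrite mulr_natl -lnXn ?ltr0n // -natrX; exact: ler_ln_nat.
have h2 := ln_le_linear d0 lm.
have h3 : ln m.+1%:R <= ln K + ln N%:R :> R.
  rewrite -lnM ?posrE //; last by lra.
  by rewrite ler_ln // posrE ?mulr_gt0 //; lra.
have h4 : d * ln m.+1%:R <= d * ln K + d * ln N%:R.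
  by rewrite -mulrDr; apply: ler_wpM2l => //; exact: ltW.
have h5 : d * ln K <= ln K by rewrite ler_piMl.
by rewrite mulrDl mul1r; lra.
Qed.

Lemma ln_expn_le (a b k M e : nat) : (0 < a)%N -> (0 < b)%N -> (0 < M)%N ->
  (a ^ k <= b ^ k * M ^ e)%N ->
  k%:R * ln (a%:R / b%:R) <= e%:R * ln M%:R :> R.
Proof.
move=> a0 b0 M0 h.
have : ln ((a ^ k)%:R : R) <= ln (b ^ k * M ^ e)%:R.
  by apply: ler_ln_nat => //; rewrite expn_gt0 a0.
rewrite natrM !natrX lnM ?posrE ?exprn_gt0 ?ltr0n //.
rewrite !lnXn ?ltr0n // ln_div ?posrE ?ltr0n //.
rewrite -(mulr_natl (ln a%:R)) -(mulr_natl (ln b%:R)) -(mulr_natl (ln M%:R)).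
by rewrite mulrBr lerBlDl.
Qed.

(** The hypothesis bounds [S./2] by a constant times [ln M]; one more logarithm makes the constant
    additive. *)
Lemma loglog_ge_card (M S : nat) : (0 < M)%N -> (0 < S)%N ->
  (128 ^ S./2 <= 81 ^ S./2 * M ^ 4)%N ->
  ln S%:R <= loglog M + (`|ln (ln 2%:R)| + `|ln (12%:R / ln (128%:R / 81%:R))|).
Proof.
move=> M0 S0 hS; set c := ln (128%:R / 81%:R : R).
have c0 : 0 < c by rewrite ln_gt0 //; lra.
have hM := loglog_ge M0.
(* For [S = 1] there is no pair, and the claim rests on [loglog_ge]. *)
have [S1|S2] := leqP S 1.
  have -> : S = 1%N by apply/eqP; rewrite eqn_leq S1.
  by rewrite ln1; have := normr_ge0 (ln (12%:R / c)); lra.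
set k := S./2; have k0 : (0 < k)%N by rewrite /k; lia.
have k0' : 0 < k%:R :> R by rewrite ltr0n.
have M0' : 0 < M%:R :> R by rewrite ltr0n.
have h1 : k%:R * c <= 4%:R * ln M%:R :> R by exact: ln_expn_le.
have lnM0 : 0 < ln M%:R :> R.
  have : 0 < k%:R * c by rewrite mulr_gt0.
  by lra.
have M1 : (M == 1)%N = false.
  by apply/eqP => M1; move: lnM0; rewrite M1 ln1 ltxx.
have h2 : ln S%:R <= ln (12%:R / c) + ln (ln M%:R) :> R.
  rewrite -lnM ?posrE ?divr_gt0 //.
  rewrite ler_ln ?posrE ?ltr0n ?mulr_gt0 ?invr_gt0 //.
  rewrite mulrAC ler_pdivlMr //.
  (* Since [k >= 1], [S <= 2k + 1 <= 3k]; with the factor [4] on [ln M] this gives the constant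
     [12]. *)
  have : S%:R <= 3%:R * k%:R :> R by rewrite -natrM ler_nat /k; lia.
  by move=> /(ler_wpM2r (ltW c0)) h; apply: le_trans h _; lra.
rewrite /loglog M1; have := ler_norm (ln (12%:R / c)).
by have := normr_ge0 (ln (ln 2%:R : R)); lra.
Qed.

End LogLog.

Lemma near_inv_nat {R : realType} (C d : R) : 0 <= C -> 0 < d ->
  \forall n \near \oo, C / n.+1%:R <= d.
Proof.
move=> C0 d0; near=> n; rewrite ler_pdivrMr // -ler_pdivrMl //.
apply: le_trans (_ : n%:R <= _); last by rewrite ler_nat.
near: n; exact: nbhs_infty_ger.
Unshelve. all: by end_near. Qed.

(** * Comparison of the two growth rates at fixed scales *)

Section Comparison.
Context {R : realType} {X : pointedMetricType R} (f : X -> X).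

Local Notation G eps := (limn_esup (fun n =>
  elog (Nspan f n.+1 eps) * ((n.+1)%:R^-1)%:E)%E).
Local Notation F eps := (limn_esup (fun n =>
  elog (elog (NM f [set: @probX R X] n.+1 eps)) * ((n.+1)%:R^-1)%:E)%E).

Lemma Nspan_cases n eps : Nspan f n eps = +oo%E \/
  exists2 s : seq X, (forall x, exists y, List.In y s /\ bowen f n x y <= eps) &
    (0 < size s)%N /\ Nspan f n eps = (size s)%:R%:E.
Proof.
have [[_ e]|[s hs es]] := @ereal_inf_size R X
  [set F : seq X | forall x, exists y, List.In y F /\ bowen f n x y <= eps].
  by left.
right; exists s => //; split=> //.
by have [y [+ _]] := hs point; case: (s).
Qed.

Lemma NM_cases n eps : NM f setT n eps = +oo%E \/
  exists2 E : seq (@probX R X),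
    (forall mu, exists nu, List.In nu E /\ (W1n f n mu nu <= eps%:E)%E) &
    (0 < size E)%N /\ NM f setT n eps = (size E)%:R%:E.
Proof.
have [[_ e]|[E hE eE]] := @ereal_inf_size R (@probX R X)
  [set E : seq (@probX R X) | forall mu, [set: @probX R X] mu ->
    exists nu, List.In nu E /\ (W1n f n mu nu <= eps%:E)%E].
  by left.
right; exists E; first by move=> mu; exact: hE.
split=> //; have [y [+ _]] := hE (\d_(point : @BorelX R X)) I.
by case: (E).
Qed.

(** Monotonicity in the scale yields the existence of the limit defining [htop]. *)
Lemma Nspan_limsup_nonincreasing (e1 e2 : R) : e1 <= e2 -> (G e2 <= G e1)%E.
Proof.
move=> e12; apply: limn_esup_le => r d d0; near=> n => hlt.
apply: le_trans (_ : r%:E <= _)%E; last by rewrite lee_fin lerDl ltW.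
apply: le_trans (ltW hlt); apply: lee_wpmul2r; first by rewrite lee_fin invr_ge0.
have [->|[s1 h1 [s10 E1]]] := Nspan_cases n.+1 e1; first exact: leey.
have le21 : (Nspan f n.+1 e2 <= (size s1)%:R%:E)%E.
  apply: ereal_inf_lbound; exists s1 => // x.
  by have [y [ys xy]] := h1 x; exists y; split => //; exact: le_trans e12.
have [e|[s2 h2 [s20 E2]]] := Nspan_cases n.+1 e2; first by rewrite e in le21.
move: le21; rewrite E1 E2 lee_fin ler_nat => le21.
by rewrite !elog_nat // lee_fin ler_ln_nat.
Unshelve. all: by end_near. Qed.

Hypothesis fc : continuous f.

(** The factor [8] undoes the [eps / 8] of [NM_cover_lower]; the additive constant [C] disappears
    after division by [n + 1]. *)
Lemma Nspan_limsup_le_NM (eps : R) : 0 < eps -> (G (8%:R * eps) <= F eps)%E.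
Proof.
move=> e0; apply: limn_esup_le => r d d0.
pose C : R := `|ln (ln 2%:R)| + `|ln (12%:R / ln (128%:R / 81%:R))|.
have C0 : 0 <= C by rewrite addr_ge0.
apply: filterS (near_inv_nat C0 d0) => n hn.
have n0 : 0 < n.+1%:R^-1 :> R by rewrite invr_gt0.
have [->|[E hE [E0 EN]]] := NM_cases n.+1 eps.
  by rewrite /= gt0_mulye ?lte_fin.
rewrite EN elog_elog_nat // -EFinM lte_fin => hlt.
have hS (S : nat) : (0 < S)%N -> (S%:R%:E <= Nspan f n.+1 (8%:R * eps))%E ->
    ln S%:R <= loglog (size E) + C :> R.
  move=> S0 hS; apply: loglog_ge_card => //.
  have [k0|k0] := posnP (S./2).
    by rewrite k0 !expn0 mul1n expn_gt0 E0.
  have [s sS sep] := separated_of_Nspan hS.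
  apply: (@NM_cover_lower R X f n.+1 fc S./2 (8%:R * eps) (nth point s)) => //.
  - by rewrite mulr_gt0.
  - by move=> i j iS jS; apply: sep; lia.
  - by move=> mu; rewrite mulrAC divff ?mul1r.
have [oo|[s hs [s0 sN]]] := Nspan_cases n.+1 (8%:R * eps).
  (* Without a finite spanning list, separated lists of every length exist; this length exceeds what
     [hS] permits. *)
  pose S := (Num.truncn (expR (loglog (size E) + C))).+1.
  have : ln S%:R <= loglog (size E) + C :> R.
    by apply: hS => //; rewrite oo leey.
  rewrite -ler_expR lnK ?posrE //.
  have /andP[_] := truncn_itv (expR_ge0 (loglog (size E) + C)).
  by move=> /lt_le_trans/[apply]; rewrite ltxx.
rewrite sN elog_nat // -EFinM lee_fin.
have h1 : ln (size s)%:R <= loglog (size E) + C :> R by apply: hS; rewrite ?sN.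
apply: le_trans (ler_wpM2r (ltW n0) h1) _; rewrite mulrDl; apply: lerD.
  exact: ltW.
exact: hn.
Qed.

Hypothesis Xc : compact [set: X].

(** Half of [eps] pays for the radius of the cells, the other half for the rounding of masses. *)
Lemma NM_limsup_le_Nspan (eps : R) : 0 < eps -> (F eps <= G (eps / 2))%E.
Proof.
move=> e0; have [D D0 hD] := compact_mdist_bounded Xc.
apply: limn_esup_le => r d d0.
(* [K] is chosen for [m + 1 <= K * N]: below, [m + 1 <= t + 2] with [t = (2 D / eps) N], and
   [2 <= 2 N]. *)
pose K : R := 2%:R * D / eps + 2%:R.
have K1 : 1 <= K.
  have : 0 <= 2%:R * D / eps by rewrite divr_ge0 ?mulr_ge0 // ltW.
  by rewrite /K; lra.
(* With this choice [a * |r| <= d / 2], so the extra term [a * ln N] costs at most [d / 2] after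
   division by [n + 1]. *)
pose a : R := d / (2%:R * `|r| + d).
have den : 0 < 2%:R * `|r| + d by have := normr_ge0 r; lra.
have a0 : 0 < a by rewrite divr_gt0.
have a1 : a <= 1 by rewrite ler_pdivrMr // mul1r; have := normr_ge0 r; lra.
have C0 : 0 <= ln K - ln a.
  by rewrite subr_ge0 (le_trans (ln_le0 a1)) // ln_ge0.
have d2 : 0 < d / 2 by rewrite divr_gt0.
apply: filterS (near_inv_nat C0 d2) => n hn.
have n0 : 0 < n.+1%:R^-1 :> R by rewrite invr_gt0.
have [->|[s hs [s0 sN]]] := Nspan_cases n.+1 (eps / 2).
  by rewrite /= gt0_mulye ?lte_fin.
rewrite sN elog_nat // -EFinM lte_fin => hlt.
set N := size s in hlt s0 sN.
have N0 : 0 < N%:R :> R by rewrite ltr0n.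
have lnN : 0 <= ln N%:R :> R by rewrite ln_ge0 // ler1n.
pose t : R := 2%:R * D / eps * N%:R.
have t0 : 0 <= t by rewrite mulr_ge0 ?divr_ge0 ?mulr_ge0 // ltW.
(* [m] exceeds [t], which makes the rounding cost [D * N / m] at most [eps / 2]. *)
pose m := (Num.truncn t).+1.
have /andP[t1 t2] := truncn_itv t0.
have m0 : 0 < m%:R :> R by rewrite ltr0n.
have eps2 : 0 <= eps / 2 by rewrite divr_ge0 // ltW.
have [E sE hE] := grid_cover fc eps2 (isT : (0 < m)%N) hD hs.
have cost : eps / 2 + D * (N%:R / m%:R) <= eps.
  suff : D * (N%:R / m%:R) <= eps / 2 by lra.
  rewrite mulrA ler_pdivrMr //.
  have : t * eps <= m%:R * eps by rewrite ler_pM2r // ltW.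
  rewrite /t mulrAC divfK ?gt_eqF // => h; lra.
have NMle : (NM f setT n.+1 eps <= (size E)%:R%:E)%E.
  apply: ereal_inf_lbound; exists E => // mu _.
  have [nu [nuE hnu]] := hE mu; exists nu; split => //.
  by apply: le_trans hnu _; rewrite lee_fin.
have [oo|[E' _ [E'0 EN]]] := NM_cases n.+1 eps; first by rewrite oo in NMle.
move: NMle; rewrite EN lee_fin ler_nat sE => E'le.
rewrite elog_elog_nat // -EFinM lee_fin.
have mK : m.+1%:R <= K * N%:R.
  rewrite /K mulrDl -/t /m -[(_ .+2)%:R]natr1 -natr1.
  have : 1 <= N%:R :> R by rewrite ler1n.
  by move=> ?; lra.
have h := loglog_le E'0 s0 (isT : (0 < m)%N) E'le mK K1 a0 a1.
apply: le_trans (ler_wpM2r (ltW n0) h) _.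
rewrite mulrDl (mulrDl 1) mul1r (mulrDl (ln N%:R)).
have hC : (ln K - ln a) / n.+1%:R <= d / 2.
  exact: hn.
have ha : a * ln N%:R / n.+1%:R <= d / 2.
  rewrite -mulrA; apply: le_trans (_ : a * `|r| <= _).
    by apply: ler_wpM2l; [exact: ltW|apply: le_trans (ltW hlt) (ler_norm _)].
  by rewrite /a mulrAC ler_pdivrMr //; have := normr_ge0 r; nra.
by apply: le_trans (lerD (lerD (ltW hlt) ha) hC) _; lra.
Qed.

End Comparison.

(** * Passage to the limit as the scale tends to zero *)

Lemma cvg_at_right0_scale {R : realType} (c : R) : 0 < c ->
  c * x @[x --> 0^'+] --> (0 : R)^'+.
Proof.
move=> c0 A [e /= e0 hA].
exists (e / c); first by rewrite /= divr_gt0.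
move=> x /=; rewrite sub0r normrN => hx x0.
apply: hA => /=; last by rewrite mulr_gt0.
by rewrite sub0r normrN normrM (gtr0_norm c0) mulrC -ltr_pdivlMr.
Qed.

Theorem theorem1p2 (R : realType) (X : pointedMetricType R) (f : X -> X) :
  compact [set: X] -> continuous f ->
  entropy_order f [set: @probX R X] = htop f.
Proof.
move=> Xc fc; rewrite /entropy_order /htop.
set F := fun eps : R => limn_esup (fun n =>
  elog (elog (NM f setT n.+1 eps)) * ((n.+1)%:R^-1)%:E)%E.
set G := fun eps : R => limn_esup (fun n =>
  elog (Nspan f n.+1 eps) * ((n.+1)%:R^-1)%:E)%E.
rewrite -/(F _) -/(G _).
have cG : cvg (G x @[x --> 0^'+]).
  apply: nonincreasing_at_right_is_cvge; near=> b => x y _ _ xy.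
  exact: Nspan_limsup_nonincreasing.
apply/cvg_lim => //.
(* Rescaling by a positive constant preserves the limit of [G] at zero from the right, so both
   bounds tend to [htop f]; the squeeze also gives the convergence of [F]. *)
apply: (@squeeze_cvge _ _ _ _ (fun x => G (8%:R * x)) _ (fun x => G (2^-1 * x))).
- near=> x; have x0 : 0 < x by near: x; exact: nbhs_right_gt.
  apply/andP; split; first exact: Nspan_limsup_le_NM.
  by rewrite mulrC; exact: NM_limsup_le_Nspan.
- by apply: cvg_comp cG; exact: cvg_at_right0_scale.
- by apply: cvg_comp cG; apply: cvg_at_right0_scale; rewrite invr_gt0.
Unshelve. all: by end_near. Qed.
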